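(* Let $\Theta\subset\mathbf{R}^d$, let $\mathcal{L}_T(u_0,\boldsymbol{\theta})$ be a local minimum distance function with stationary counterpart $\tilde{\mathcal{L}}_T(u_0,\boldsymbol{\theta})$ and limit function $\mathcal{L}(u_0,\boldsymbol{\theta})$, let $\mathcal{B}_T:=\mathcal{L}_T-\tilde{\mathcal{L}}_T$, and let $$\hat{\boldsymbol{\theta}}_T(u_0):=\operatorname{argmin}_{\boldsymbol{\theta}\in\Theta}\mathcal{L}_T(u_0,\boldsymbol{\theta}),\qquad \boldsymbol{\theta}_0(u_0):=\operatorname{argmin}_{\boldsymbol{\theta}\in\Theta}\mathcal{L}(u_0,\boldsymbol{\theta}).$$ (i) Fix $u_0$. Suppose that $\Theta$ is compact with $\boldsymbol{\theta}_0(u_0)\in\mathrm{Int}(\Theta)$, that the function $\mathcal{L}(u_0,\boldsymbol{\theta})$ is continuous in $\boldsymbol{\theta}$, and that the minimum $\boldsymbol{\theta}_0(u_0)$ is unique. If, as $T\to\infty$, $$\sup_{\boldsymbol{\theta}\in\Theta}\big|\tilde{\mathcal{L}}_T(u_0,\boldsymbol{\theta})-\mathcal{L}(u_0,\boldsymbol{\theta})\big|\stackrel{P}{\rightarrow}0\qquad\text{and}\qquad \sup_{\boldsymbol{\theta}\in\Theta}\big|\mathcal{B}_T(u_0,\boldsymbol{\theta})\big|\stackrel{P}{\rightarrow}0,$$ then $$\hat{\boldsymbol{\theta}}_T(u_0)\stackrel{P}{\rightarrow}\boldsymbol{\theta}_0(u_0).$$ (ii) Suppose that the assumptions of part (i)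 hold for every $u_0\in[0,1]$, and in addition that $\mathcal{L}(u,\boldsymbol{\theta})$ and $\boldsymbol{\theta}_0(u)$ are uniformly continuous in $u\in[0,1]$ and $\boldsymbol{\theta}\in\Theta$ and that both convergences in part (i) are uniform in $u_0\in[0,1]$, i.e. $$\sup_{u_0\in[0,1]}\sup_{\boldsymbol{\theta}\in\Theta}\big|\tilde{\mathcal{L}}_T(u_0,\boldsymbol{\theta})-\mathcal{L}(u_0,\boldsymbol{\theta})\big|\stackrel{P}{\rightarrow}0,\qquad \sup_{u_0\in[0,1]}\sup_{\boldsymbol{\theta}\in\Theta}\big|\mathcal{B}_T(u_0,\boldsymbol{\theta})\big|\stackrel{P}{\rightarrow}0.$$ Then $$\sup_{u_0\in[0,1]}\big|\hat{\boldsymbol{\theta}}_T(u_0)-\boldsymbol{\theta}_0(u_0)\big|\stackrel{P}{\rightarrow}0.$$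
   Context: Setting: $X_{t,T}$, $t=1,\dots,T$, $T\in\mathbf{N}$, is a triangular array of random variables (a nonstationary process in rescaled time $t/T\in[0,1]$), and for each rescaled time point $u_0$ there is a stationary process $\tilde X_t(u_0)$, called the stationary approximation of $X_{t,T}$ at $u_0$, defined on the same probability space. The parameter space is $\Theta\subset\mathbf{R}^d$. For each $u_0$ and $T$, $\mathcal{L}_T(u_0,\boldsymbol{\theta})$, $\boldsymbol{\theta}\in\Theta$, is an arbitrary real-valued local minimum distance function (for example a kernel-weighted negative local conditional log-likelihood) computed from the observations $X_{1,T},\dots,X_{T,T}$. The function $\tilde{\mathcal{L}}_T(u_0,\boldsymbol{\theta})$ is the same function, but with $X_{t,T}$ replaced by $\tilde X_t(u_0)$. The function $\mathcal{L}(u_0,\boldsymbol{\theta})$ is a deterministic limit function. The difference is denoted by $\mathcal{B}_T(u_0,\boldsymbol{\theta}):=\mathcal{L}_T(u_0,\boldsymbol{\theta})-\tilde{\mathcal{L}}_T(u_0,\boldsymbol{\theta})$. The estimator $\hat{\boldsymbol{\theta}}_T(u_0)$ is a minimizer of $\mathcal{L}_T(u_0,\cdot)$ over $\Theta$. The symbol $\stackrel{P}{\rightarrow}$ denotes convergence in probability as $T\to\infty$, $\mathrm{Int}(\Theta)$ is the interior of $\Theta$, and $|\cdot|$ is the Euclidean norm for vectors. *)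

(* Defs.v *)
From HB Require Import structures.
From mathcomp Require Import all_boot all_order all_algebra.
From mathcomp Require Import all_classical all_reals all_analysis.
Set Implicit Arguments.
Unset Strict Implicit.
Unset Printing Implicit Defensive.
Import Order.TTheory GRing.Theory Num.Theory.
Import numFieldNormedType.Exports.
Local Open Scope classical_set_scope.
Local Open Scope ring_scope.

(* The library norm on row vectors is the sup norm. *)
Definition enorm (R : realType) (d : nat) (x : 'rV[R]_d) : R :=
  Num.sqrt (\sum_(i < d) x ord0 i ^+ 2).

Definition is_argmin (R : realType) (U : Type) (A : set U) (f : U -> R)
    (x : U) : Prop :=
  A x /\ forall y, A y -> f x <= f y.

(* Extended-real valued, so that the supremum of an unbounded function is
   +oo (the real-valued [sup] would return 0). *)
Definition sup_abs (R : realType) (U : Type) (A : set U) (f : U -> R) : \bar R :=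
  ereal_sup [set `|f x|%:E | x in A].

(* Convergence to 0 in probability of a sequence of nonnegative extended-real
   functions.  Suprema over uncountable sets and minimizers need not be
   measurable, hence the outer probability P^*, which coincides with P on
   measurable events. *)
Definition cvg_in_prob0 (R : realType) (disp : measure_display)
    (Omega : measurableType disp) (P : probability Omega R)
    (Y : nat -> Omega -> \bar R) : Prop :=
  forall eps : R, 0 < eps ->
    mu_ext P [set w | (eps%:E < Y T w)%E] @[T --> \oo] --> 0%E.

Definition strictly_stationary (R : realType) (disp : measure_display)
    (Omega : measurableType disp) (P : probability Omega R)
    (Y : int -> {RV P >-> R}) : Prop :=
  forall (n : nat) (t : 'I_n -> int) (h : int) (A : set (n.-tuple R)),
    measurable A ->
    P [set w | A [tuple Y (t i) w | i < n]] =
    P [set w | A [tuple Y (t i + h) w | i < n]].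

(* The ordinal t : 'I_T stands for the time point t + 1 of {1, ..., T}. *)
Definition local_dist (R : realType) (disp : measure_display)
    (Omega : measurableType disp) (P : probability Omega R) (d : nat)
    (M : forall T : nat, R -> 'rV[R]_d -> T.-tuple R -> R)
    (X : forall T : nat, 'I_T -> {RV P >-> R})
    (T : nat) (u : R) (theta : 'rV[R]_d) (w : Omega) : R :=
  M T u theta [tuple X T t w | t < T].

Definition stationary_local_dist (R : realType) (disp : measure_display)
    (Omega : measurableType disp) (P : probability Omega R) (d : nat)
    (M : forall T : nat, R -> 'rV[R]_d -> T.-tuple R -> R)
    (Xtilde : R -> int -> {RV P >-> R})
    (T : nat) (u : R) (theta : 'rV[R]_d) (w : Omega) : R :=
  M T u theta [tuple Xtilde u (Posz (nat_of_ord t).+1) w | t < T].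

(* LT, LtT, BT, L and thetahat, theta0 are the local minimum distance function,
   its stationary counterpart, their difference, the limit function and the
   minimizers of LT and L. *)
Record pointwise_assumptions (R : realType) (disp : measure_display)
    (Omega : measurableType disp) (P : probability Omega R) (d : nat)
    (Theta : set 'rV[R]_d)
    (LT LtT BT : nat -> R -> 'rV[R]_d -> Omega -> R)
    (L : R -> 'rV[R]_d -> R)
    (thetahat : nat -> R -> Omega -> 'rV[R]_d)
    (theta0 : R -> 'rV[R]_d) (u0 : R) : Prop := PointwiseAssumptions {
  thetahat_argmin : forall (T : nat) (w : Omega), (0 < T)%N ->
    is_argmin Theta (fun theta => LT T u0 theta w) (thetahat T u0 w);
  theta0_argmin : is_argmin Theta (L u0) (theta0 u0);
  theta0_unique : forall theta : 'rV[R]_d,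
    is_argmin Theta (L u0) theta -> theta = theta0 u0;
  Theta_compact : compact Theta;
  theta0_interior : Theta° (theta0 u0);
  L_continuous : {within Theta, continuous (L u0)};
  LtT_cvg : cvg_in_prob0 P (fun T w =>
    sup_abs Theta (fun theta => LtT T u0 theta w - L u0 theta));
  BT_cvg : cvg_in_prob0 P (fun T w =>
    sup_abs Theta (fun theta => BT T u0 theta w))
}.

(* Main.v *)
Require Import Defs.
From HB Require Import structures.
From mathcomp Require Import all_boot all_order all_algebra.
From mathcomp Require Import lra.
From mathcomp Require Import all_classical all_reals all_analysis.
Set Implicit Arguments.
Unset Strict Implicit.
Unset Printing Implicit Defensive.
Import Order.TTheory GRing.Theory Num.Theory.
Import numFieldNormedType.Exports.
Local Open Scope classical_set_scope.
Local Open Scope ring_scope.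

(** Write [L] for the limit function, [theta0 u] for its unique minimizer at
    [u] and [U] for the set of time points over which the claim is uniform.
    The argument is the classical one for minimum contrast estimators.

    Separation ([argmin_well_separated]): for compact [U] and [Theta], away from
    the minimizer the limit function stays above its minimum by a margin that
    does not depend on [u]: for each [eps > 0] there is [delta > 0] such that
    [eps <= enorm (theta - theta0 u)] implies
    [delta <= L u theta - L u (theta0 u)].  Indeed this gap is a continuous
    function of [(u, theta)] on the compact set [U `*` Theta], and by uniqueness
    it vanishes only at [theta = theta0 u].

    Perturbation ([argmin_gap_le]): a minimizer over [Theta] of a function
    uniformly within [c] of [L u] has a gap of at most [2 c].  The local minimum
    distance function differs from [L u] by at most
    [sup |LtT - L| + sup |LT - LtT|], so the estimator can only be at distance
    more than [eps] from [theta0 u] for some [u] in [U] when one of the two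
    suprema exceeds [delta / 5].

    Conclusion ([argmin_consistency]): the outer probability of the former event
    is bounded by the sum of the outer probabilities of the latter two, by
    monotonicity and subadditivity; no measurability is needed.

    The pointwise claim is the case [U = [set u0]] and the uniform claim is the
    case [U = `[0, 1]]. *)

(** * Continuity on a subset *)

Lemma unif_continuous_continuous (U V : uniformType) (f : U -> V) :
  unif_continuous f -> continuous f.
Proof.
move=> uf x B; rewrite -!nbhs_entourageE => -[E entE EB].
exists ((fun xy : U * U => (f xy.1, f xy.2)) @^-1` E); first exact: uf.
by move=> y /xsectionP Exy; apply: EB; exact/xsectionP.
Qed.

Lemma within_continuous_comp_sub (U V W : topologicalType) (A : set U)
    (B : set V) (f : U -> V) (g : V -> W) :
  (forall x, A x -> B (f x)) ->
  {within A, continuous f} -> {within B, continuous g} ->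
  {within A, continuous (g \o f)}.
Proof.
move=> AB /subspace_continuousP cf /subspace_continuousP cg.
apply/subspace_continuousP => x Ax.
apply: cvg_comp (cg _ (AB _ Ax)) => C /= /(cf _ Ax).
rewrite !nbhs_simpl /within /=; apply: filterS => y ABC Ay.
by apply: ABC => //; exact: AB.
Qed.

Lemma within_continuous_pair (U V W : topologicalType) (A : set U)
    (f : U -> V) (g : U -> W) :
  {within A, continuous f} -> {within A, continuous g} ->
  {within A, continuous (fun x => (f x, g x))}.
Proof.
by move=> cf cg x; apply: cvg_pair; [exact: cf|exact: cg].
Qed.

(** * The Euclidean norm *)

Lemma enorm_continuous (R : realType) (d : nat) :
  continuous (@enorm R d).
Proof.
move=> x; apply: continuous_comp; last exact: sqrt_continuous.
apply: cvg_big => [||i _]; [exact: add_continuous|exact: nbhs_filter|].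
apply: (@continuous_comp _ _ _ (fun y : 'rV[R]_d => y ord0 i)
  (fun r : R => r ^+ 2)).
  exact: coord_continuous.
exact: exprn_continuous.
Qed.

Lemma within_continuous_enormB (R : realType) (d : nat) (U : topologicalType)
    (A : set U) (f g : U -> 'rV[R]_d) :
  {within A, continuous f} -> {within A, continuous g} ->
  {within A, continuous (fun x => enorm (f x - g x))}.
Proof.
move=> cf cg; apply: (@within_continuous_comp_sub _ _ _ A setT
  (fun x => f x - g x) (@enorm R d)) => //.
  exact: within_continuousB.
by apply: continuous_subspaceT; exact: enorm_continuous.
Qed.

Lemma enorm0 (R : realType) (d : nat) : enorm (0 : 'rV[R]_d) = 0.
Proof.
by rewrite /enorm big1 ?sqrtr0// => i _; rewrite mxE expr0n.
Qed.

(** * Separation of a unique minimizer *)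

Lemma unique_argmin_gap_gt0 (R : realType) (d : nat) (A : set 'rV[R]_d)
    (f : 'rV[R]_d -> R) (x0 x : 'rV[R]_d) (eps : R) :
  is_argmin A f x0 -> (forall y, is_argmin A f y -> y = x0) ->
  0 < eps -> A x -> eps <= enorm (x - x0) -> 0 < f x - f x0.
Proof.
move=> [Ax0 fx0] uniq eps0 Ax; rewrite subr_gt0 ltNge; apply: contraTN => fx.
rewrite (uniq x) ?subrr ?enorm0 -?ltNge//.
by split=> // y Ay; exact: le_trans fx (fx0 _ Ay).
Qed.

(** A nonnegative continuous [gap] on a compact set that is positive wherever
    [dist] is at least [eps] is bounded away from [0] there. *)
Lemma compact_well_separated (R : realType) (T : topologicalType) (K : set T)
    (gap dist : T -> R) (eps : R) :
  compact K -> {within K, continuous gap} -> {within K, continuous dist} ->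
  (forall x, K x -> 0 <= gap x) ->
  (forall x, K x -> eps <= dist x -> 0 < gap x) ->
  exists2 delta : R, 0 < delta &
    forall x, K x -> eps <= dist x -> delta <= gap x.
Proof.
move=> cK cgap cdist gap0 gap_gt0.
(* The added term leaves [gap] unchanged where [eps <= dist x] and makes it
   positive elsewhere, so that the minimum can be taken over [K] itself. *)
pose h x := gap x + Num.max 0 (eps - dist x).
have ch : {within K, continuous h}.
  apply: within_continuousD => // x.
  apply: (@continuous_max R (subspace K) (fun=> 0) (fun x => eps - dist x)).
    exact: cvg_cst.
  by apply: cvgB; [exact: cvg_cst|exact: cdist].
have [K0|/set0P/negP/negPn/eqP->] := pselect (K !=set0); last first.
  by exists 1.
have [c cK' hc] := compact_EVT_min K0 cK ch; rewrite inE in cK'.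
exists (h c).
  rewrite /h; have [ec|ec] := leP eps (dist c).
    by rewrite ltr_wpDr ?le_max ?lexx// gap_gt0.
  by rewrite ltr_wpDl ?gap0// lt_max subr_gt0 ec orbT.
move=> x Kx ex; apply: (le_trans (hc x _)); first by rewrite inE.
by rewrite /h max_l ?addr0// subr_le0.
Qed.

(** Uniqueness of the minimizer [theta0 u] improves to separation, uniformly in
    the parameter [u]. *)
Lemma argmin_well_separated (R : realType) (T : topologicalType) (d : nat)
    (U : set T) (Theta : set 'rV[R]_d) (L : T -> 'rV[R]_d -> R)
    (theta0 : T -> 'rV[R]_d) :
  compact U -> compact Theta ->
  {within U `*` Theta, continuous (fun p => L p.1 p.2)} ->
  {within U, continuous theta0} ->
  (forall u, U u -> is_argmin Theta (L u) (theta0 u)) ->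
  (forall u theta, U u -> is_argmin Theta (L u) theta -> theta = theta0 u) ->
  forall eps : R, 0 < eps -> exists2 delta : R, 0 < delta &
    forall u theta, U u -> Theta theta -> eps <= enorm (theta - theta0 u) ->
      delta <= L u theta - L u (theta0 u).
Proof.
move=> cU cTheta cL ct min0 uniq0 eps eps0.
pose K : set (T * 'rV[R]_d) := U `*` Theta.
have csnd : {within K, continuous (@snd T 'rV[R]_d)}.
  by apply: continuous_subspaceT => x; apply: cvg_snd.
have cfst : {within K, continuous (@fst T 'rV[R]_d)}.
  by apply: continuous_subspaceT => x; apply: cvg_fst.
have ct0 : {within K, continuous (fun p : T * 'rV[R]_d => theta0 p.1)}.
  apply: (@within_continuous_comp_sub (T * 'rV[R]_d)%type T 'rV[R]_d K U fst
    theta0) => //.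
  by move=> x [].
have cL0 : {within K, continuous (fun p => L p.1 (theta0 p.1))}.
  apply: (@within_continuous_comp_sub (T * 'rV[R]_d)%type
    (T * 'rV[R]_d)%type R K K (fun p => (p.1, theta0 p.1))
    (fun p => L p.1 p.2)) => //.
    by move=> x [Ux _]; split => //; exact: (min0 _ Ux).1.
  exact: within_continuous_pair.
have [] := @compact_well_separated R _ K
    (fun p => L p.1 p.2 - L p.1 (theta0 p.1))
    (fun p => enorm (p.2 - theta0 p.1)) eps.
- exact: compact_setX.
- exact: within_continuousB.
- exact: within_continuous_enormB.
- by move=> p [Up Tp]; rewrite subr_ge0 (min0 _ Up).2.
- move=> p [Up Tp]; apply: unique_argmin_gap_gt0 eps0 Tp; first exact: min0.
  by move=> theta; exact: uniq0.
move=> delta delta0 sep; exists delta => // u theta Uu Ttheta.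
exact: (sep (u, theta)).
Qed.

(** * Minimizers of a perturbed function *)

Lemma argmin_gap_le (R : realType) (U : Type) (A : set U) (f g : U -> R)
    (x y : U) (delta : R) :
  is_argmin A f x -> A y ->
  (forall z, A z -> `|f z - g z| <= delta) ->
  g x - g y <= delta *+ 2.
Proof.
move=> [Ax fx] Ay fg; have := fx _ Ay.
have := fg _ Ax; have := fg _ Ay; rewrite !ler_norml mulr2n; lra.
Qed.

Lemma sup_abs_le (R : realType) (U : Type) (A : set U) (f : U -> R) (c : R) :
  (sup_abs A f <= c%:E)%E -> forall x, A x -> `|f x| <= c.
Proof.
move=> /ereal_supP fc x Ax; rewrite -lee_fin.
by apply: fc; exists x.
Qed.

(** * Convergence in outer probability *)

(** The implication between events is only needed for [0 < T]: the index
    [T = 0], which carries no observation, is irrelevant for the limit. *)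
Lemma cvg_in_prob0_union (R : realType) (disp : measure_display)
    (Omega : measurableType disp) (P : probability Omega R)
    (Y1 Y2 Z : nat -> Omega -> \bar R) :
  cvg_in_prob0 P Y1 -> cvg_in_prob0 P Y2 ->
  (forall eps : R, 0 < eps -> exists2 delta : R, 0 < delta &
    forall (T : nat) (w : Omega), (0 < T)%N -> (eps%:E < Z T w)%E ->
      (delta%:E < Y1 T w)%E \/ (delta%:E < Y2 T w)%E) ->
  cvg_in_prob0 P Z.
Proof.
move=> cY1 cY2 YZ eps eps0; have [delta delta0 {}YZ] := YZ eps eps0.
have cY := cvgeD (isT : (0 +? 0)%E) (cY1 _ delta0) (cY2 _ delta0).
rewrite adde0 in cY.
apply: (squeeze_cvge _ (cvg_cst 0%E) (cY _)).
near=> T; apply/andP; split; first exact: mu_ext_ge0.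
apply: le_trans (outer_measureU2 (mu_ext P) _ _).
apply: le_mu_ext => w /= Zw; apply: YZ => //.
by near: T; exact: nbhs_infty_gt.
Unshelve. all: by end_near. Qed.

Lemma cvg_in_prob0_ereal_sup1 (R : realType) (disp : measure_display)
    (Omega : measurableType disp) (P : probability Omega R) (V : Type)
    (g : nat -> V -> Omega -> \bar R) (v : V) :
  cvg_in_prob0 P (fun T w => ereal_sup [set g T u w | u in [set v]]) =
  cvg_in_prob0 P (fun T w => g T v w).
Proof.
congr (cvg_in_prob0 P _); apply/funext => T; apply/funext => w.
by rewrite image_set1 ereal_sup1.
Qed.

(** Consistency of minimizers, uniformly over [U], for arbitrary random
    functions and a limit function whose minimizers are well separated. *)
Lemma argmin_consistency (R : realType) (disp : measure_display)
    (Omega : measurableType disp) (P : probability Omega R) (d : nat)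
    (U : set R) (Theta : set 'rV[R]_d)
    (LT LtT : nat -> R -> 'rV[R]_d -> Omega -> R) (L : R -> 'rV[R]_d -> R)
    (thetahat : nat -> R -> Omega -> 'rV[R]_d) (theta0 : R -> 'rV[R]_d) :
  (forall u T w, U u -> (0 < T)%N ->
    is_argmin Theta (fun theta => LT T u theta w) (thetahat T u w)) ->
  (forall u, U u -> Theta (theta0 u)) ->
  (forall eps : R, 0 < eps -> exists2 delta : R, 0 < delta &
    forall u theta, U u -> Theta theta -> eps <= enorm (theta - theta0 u) ->
      delta <= L u theta - L u (theta0 u)) ->
  cvg_in_prob0 P (fun T w =>
    ereal_sup [set sup_abs Theta (fun theta => LtT T u theta w - L u theta)
              | u in U]) ->
  cvg_in_prob0 P (fun T w =>
    ereal_sup [set sup_abs Theta (fun theta => LT T u theta w - LtT T u theta w)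
              | u in U]) ->
  cvg_in_prob0 P (fun T w =>
    ereal_sup [set (enorm (thetahat T u w - theta0 u))%:E | u in U]).
Proof.
move=> hat_min theta0_in sep cLt cB; apply: cvg_in_prob0_union cLt cB _.
move=> eps /sep[delta delta0 {}sep].
(* The two errors add up to at most [2 delta / 5], which bounds the gap of
   the estimator by [4 delta / 5], strictly less than [delta]. *)
exists (delta / 5); first by rewrite divr_gt0.
move=> T w T0 /ereal_sup_gt[_ [u Uu <-]]; rewrite lte_fin => /ltW far.
apply: contrapT => /not_orP[/negP + /negP]; rewrite -!leNgt.
move=> /ereal_supP Lt_le /ereal_supP B_le.
have {}Lt_le := sup_abs_le (Lt_le _ (imageP _ Uu)).
have {}B_le := sup_abs_le (B_le _ (imageP _ Uu)).
have hat := hat_min u T w Uu T0.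
have := sep u _ Uu hat.1 far.
have : L u (thetahat T u w) - L u (theta0 u) <= (delta / 5 + delta / 5) *+ 2.
  apply: (argmin_gap_le hat (theta0_in _ Uu)) => theta Th.
  rewrite -(subrKA (LtT T u theta w)).
  by rewrite (le_trans (ler_normD _ _))// lerD ?B_le ?Lt_le.
rewrite mulr2n; lra.
Qed.

Theorem theorem3p2 (R : realType) (disp : measure_display)
    (Omega : measurableType disp) (P : probability Omega R)
    (X : forall T : nat, 'I_T -> {RV P >-> R})
    (Xtilde : R -> int -> {RV P >-> R})
    (Xtilde_stationary : forall u : R, `[0, 1]%classic u -> strictly_stationary (Xtilde u))
    (d : nat) (Theta : set 'rV[R]_d)
    (M : forall T : nat, R -> 'rV[R]_d -> T.-tuple R -> R)
    (L : R -> 'rV[R]_d -> R)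
    (thetahat : nat -> R -> Omega -> 'rV[R]_d)
    (theta0 : R -> 'rV[R]_d) :
  let LT := local_dist M X in
  let LtT := stationary_local_dist M Xtilde in
  let BT := fun (T : nat) (u : R) (theta : 'rV[R]_d) (w : Omega) =>
    LT T u theta w - LtT T u theta w in
  (forall u0 : R, `[0, 1]%classic u0 ->
    pointwise_assumptions P Theta LT LtT BT L thetahat theta0 u0 ->
    cvg_in_prob0 P (fun T w => (enorm (thetahat T u0 w - theta0 u0))%:E))
  /\
  ((forall u0 : R, `[0, 1]%classic u0 ->
      pointwise_assumptions P Theta LT LtT BT L thetahat theta0 u0) ->
   unif_continuous ((fun p : R * 'rV[R]_d => L p.1 p.2)
     : subspace (`[0, 1]%classic `*` Theta) -> R) ->
   unif_continuous (theta0 : subspace `[0, 1]%classic -> 'rV[R]_d) ->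
   cvg_in_prob0 P (fun T w =>
     ereal_sup [set sup_abs Theta (fun theta => LtT T u theta w - L u theta)
               | u in `[0, 1]%classic]) ->
   cvg_in_prob0 P (fun T w =>
     ereal_sup [set sup_abs Theta (fun theta => BT T u theta w)
               | u in `[0, 1]%classic]) ->
   cvg_in_prob0 P (fun T w =>
     ereal_sup [set (enorm (thetahat T u w - theta0 u))%:E | u in `[0, 1]%classic])).
Proof.
move=> LT LtT BT; split.
  move=> u0 _ [hat_min [theta0_in theta0_min] theta0_uniq cTheta _ cL cLt cB].
  rewrite -(cvg_in_prob0_ereal_sup1 P
    (fun T u w => (enorm (thetahat T u w - theta0 u))%:E)).
  apply: (@argmin_consistency _ _ _ P _ _ Theta LT LtT L).
  - by move=> _ T w ->; exact: hat_min.
  - by move=> _ ->.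
  - apply: argmin_well_separated => //.
    + exact: compact_set1.
    + apply: (@subspace_eq_continuous _ _ _ (fun p => L u0 p.2)).
        by move=> [u theta]; rewrite inE => -[/= ->].
      apply: (@within_continuous_comp_sub (R * 'rV[R]_d)%type 'rV[R]_d R _ Theta
        snd (L u0)) => //; first by move=> x [].
      by apply: continuous_subspaceT => x; apply: cvg_snd.
    + apply: (@subspace_eq_continuous _ _ _ (fun=> theta0 u0)).
        by move=> u; rewrite inE => ->.
      by apply: continuous_subspaceT => x; exact: cst_continuous.
    + by move=> _ ->; split.
    + by move=> _ theta ->; exact: theta0_uniq.
  - by rewrite (cvg_in_prob0_ereal_sup1 P (fun T u w =>
      sup_abs Theta (fun theta => LtT T u theta w - L u theta))).
  - by rewrite (cvg_in_prob0_ereal_sup1 P (fun T u w =>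
      sup_abs Theta (fun theta => LT T u theta w - LtT T u theta w))).
move=> A ucL uct cLt cB.
apply: (argmin_consistency _ _ _ cLt cB).
- by move=> u T w Uu T0; exact: (thetahat_argmin (A u Uu)).
- by move=> u Uu; exact: (theta0_argmin (A u Uu)).1.
apply: argmin_well_separated.
- exact: segment_compact.
- apply: (Theta_compact (A 0 _)).
  by rewrite /= in_itv /= lexx ler01.
- exact: unif_continuous_continuous.
- exact: unif_continuous_continuous.
- by move=> u Uu; exact: (theta0_argmin (A u Uu)).
- by move=> u theta Uu; exact: (theta0_unique (A u Uu)).
Qed.
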